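(* Let $F:\mathbb{R}^n\to\mathbb{R}$ be continuous, bounded below by $F_{l.b.}>-\infty$, and differentiable with locally Lipschitz continuous gradient $\dot F$. Let the algorithm described in the context be applied to $F$ from an arbitrary $\theta_0\in\mathbb{R}^n$, and let $\{\ell_t:t+1\in\mathbb{N}\}$ be the indices of accepted iterates defined in the context. Suppose there exists $k\in\{0,1,2,\ldots\}$ such that $\theta_k$ is in a bounded level set of $F$, that is, there is $s\in\mathbb{R}$ such that $\{\psi:F(\psi)\le s\}$ is bounded and contains $\theta_k$. Then either the algorithm terminates in finite time at a stationary point, or there exists $\underline\delta>0$ with $\delta_k\ge\underline\delta$ for all $k\in\{0,1,2,\ldots\}$ such that, for all $T\in\mathbb{N}$, $$\min_{t\in\{0,\ldots,T-1\}}\|\dot F(\theta_{\ell_t})\|_2^2\le\frac{F(\theta_0)-F_{l.b.}}{T\rho\,\underline\delta\,\underline\alpha},$$ where $\underline\alpha=10^{-16}$.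
   Context: Algorithm. $F:\mathbb{R}^n\to\mathbb{R}$ is differentiable with gradient $\dot F$. Inputs: $\theta_0\in\mathbb{R}^n$, $\rho\in(0,1)$, $\overline\delta\in(0,\infty)$, $\delta_0\in(0,\overline\delta]$. Set $\tau_{\mathrm{low}}^0=\|\dot F(\theta_0)\|_2/\sqrt2$ and $\tau_{\mathrm{upp}}^0=\sqrt{10}\,\|\dot F(\theta_0)\|_2$. For outer iterations $k=0,1,2,\ldots$: if $\dot F(\theta_k)=0$, terminate. Otherwise set $\psi_0^k=\theta_k$, $j=0$, and run the inner loop: (i) Compute $\hat L_j^k$: $\hat L_0^0=1$; $\hat L_0^k=\hat L_{j_{k-1}}^{k-1}$ for $k>0$; and for $j>0$, with $q=\|\dot F(\psi_j^k)-\dot F(\psi_{j-1}^k)\|_2/\|\psi_j^k-\psi_{j-1}^k\|_2$, set $\hat L_j^k=q$ if $k=0$ or $\theta_k\ne\theta_{k-1}$, and $\hat L_j^k=\max(q,\hat L_{j-1}^k)$ if $k>0$ and $\theta_k=\theta_{k-1}$. (ii) With $g=\|\dot F(\psi_j^k)\|_2$, set $C_{j,1}^k=g^3+\tfrac12 g^2\hat L_j^k+10^{-16}$, $C_{j,2}^k=g+\tfrac12\hat L_j^k+10^{-16}$, and $\alpha_j^k=\min\big((\tau_{\mathrm{low}}^k)^2/C_{j,1}^k,\ 1/C_{j,2}^k\big)+10^{-16}$. (iii) Check whether a triggering event occurs: $\|\psi_j^k-\theta_k\|_2>10$, or $\|\dot F(\psi_j^k)\|_2\notin(\tau_{\mathrm{low}}^k,\tau_{\mathrm{upp}}^k)$,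 or $j=100$. If none occurs, set $\psi_{j+1}^k=\psi_j^k-\delta_k\alpha_j^k\dot F(\psi_j^k)$, replace $j$ by $j+1$, and return to (i). If one occurs, set $j_k=j$ (one has $0<j_k\le100$), exit the inner loop, and update as follows: - (reject) if $F(\psi_{j_k}^k)\ge F(\theta_k)-\rho\delta_k\alpha_0^k\|\dot F(\theta_k)\|_2^2$: $\theta_{k+1}=\theta_k$, $\delta_{k+1}=\tfrac12\delta_k$, thresholds unchanged; - (accept) else if $\|\dot F(\psi_{j_k}^k)\|_2\le\tau_{\mathrm{low}}^k$: $\theta_{k+1}=\psi_{j_k}^k$, $\delta_{k+1}=\delta_k$, $\tau_{\mathrm{low}}^{k+1}=\|\dot F(\theta_{k+1})\|_2/\sqrt2$, $\tau_{\mathrm{upp}}^{k+1}=\sqrt{20}\,\tau_{\mathrm{low}}^{k+1}$; - (accept) else if $\|\dot F(\psi_{j_k}^k)\|_2\ge\tau_{\mathrm{upp}}^k$: $\theta_{k+1}=\psi_{j_k}^k$, $\delta_{k+1}=\min\{1.5\,\delta_k,\overline\delta\}$, $\tau_{\mathrm{low}}^{k+1}=\|\dot F(\theta_{k+1})\|_2/\sqrt2$, $\tau_{\mathrm{upp}}^{k+1}=\sqrt{20}\,\tau_{\mathrm{low}}^{k+1}$; - (accept) else: $\theta_{k+1}=\psi_{j_k}^k$, $\delta_{k+1}=\min\{1.5\,\delta_k,\overline\delta\}$, thresholds unchanged. If the algorithm terminates at outer iteration $K$, put $\theta_k=\theta_K$ and $\delta_k=\delta_K$ for $k\ge K$. Accepted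 iterates: $\ell_0=0$ and $\ell_t=\min\{k>\ell_{t-1}:\theta_k\ne\theta_{\ell_{t-1}}\}$ for $t\in\mathbb{N}$, with $\ell_t=\infty$ if no such finite $k$ exists or if $\ell_{t-1}=\infty$. (In the non-terminating alternative the claim includes that the $\ell_t$ appearing are finite.) A function is locally Lipschitz continuous if every point has an open ball around it on which the function is Lipschitz continuous. *)

(* Defs.v *)
From HB Require Import structures.
From mathcomp Require Import all_boot all_order all_algebra.
From mathcomp Require Import boolp classical_sets reals topology normedtype.
From mathcomp Require Import derive.

Set Implicit Arguments.
Unset Strict Implicit.
Unset Printing Implicit Defensive.

Import Order.TTheory GRing.Theory Num.Theory.
Import numFieldNormedType.Exports.

Local Open Scope classical_set_scope.
Local Open Scope ring_scope.

(* The norm that the library puts on 'rV[R]_n is the sup norm; [enorm] is the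
   Euclidean norm, which is the one the algorithm computes with. *)
Definition enorm (R : realType) (n : nat) (x : 'rV[R]_n) : R :=
  Num.sqrt (\sum_(i < n) x ord0 i ^+ 2).

Definition gradient (R : realType) (n : nat) (F : 'rV[R]_n -> R)
    (x : 'rV[R]_n) : 'rV[R]_n :=
  \row_(i < n) 'D_(delta_mx ord0 i) F x.

(* [ball] and [lipschitz] refer to the library (sup) norm; as all norms on R^n
   are equivalent, the Euclidean norm gives the same class of functions. *)
Definition locally_lipschitz (R : realType) (n m : nat)
    (f : 'rV[R]_n -> 'rV[R]_m) : Prop :=
  forall x : 'rV[R]_n,
    exists2 r : R, 0 < r & [lipschitz f y | y in ball x r].

Definition tiny {R : realType} : R := 10 ^- 16.

(* The data available at the start of outer iteration k. *)
Record outer_state (R : realType) (n : nat) := OuterState {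
  st_theta : 'rV[R]_n;
  st_delta : R;
  st_low : R;
  st_upp : R;
  st_L0 : R;          (* \hat L_0^k *)
  st_stalled : bool   (* k > 0 and theta_k = theta_(k-1) *)
}.

Definition step_size (R : realType) (low g L : R) : R :=
  let C1 := g ^+ 3 + 2^-1 * g ^+ 2 * L + tiny in
  let C2 := g + 2^-1 * L + tiny in
  Num.min (low ^+ 2 / C1) C2^-1 + tiny.

(* (psi_j^k, \hat L_j^k). The recursion runs past the exit index j_k; only
   the values with j <= j_k are ever used. *)
Fixpoint inner (R : realType) (n : nat) (F : 'rV[R]_n -> R)
    (s : outer_state R n) (j : nat) : 'rV[R]_n * R :=
  match j with
  | 0 => (st_theta s, st_L0 s)
  | j'.+1 =>
      let: (psi, L) := inner F s j' in
      let alpha := step_size (st_low s) (enorm (gradient F psi)) L in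
      let psi' := psi - (st_delta s * alpha) *: gradient F psi in
      let q := enorm (gradient F psi' - gradient F psi) / enorm (psi' - psi) in
      (psi', if st_stalled s then Num.max q L else q)
  end.

Definition triggered (R : realType) (n : nat) (F : 'rV[R]_n -> R)
    (s : outer_state R n) (j : nat) : bool :=
  let psi := (inner F s j).1 in
  [|| 10 < enorm (psi - st_theta s),
      ~~ (st_low s < enorm (gradient F psi) < st_upp s)
    | j == 100%N].

(* j_k: the least triggered j; it exists because j = 100 is triggered. *)
Definition exit_index (R : realType) (n : nat) (F : 'rV[R]_n -> R)
    (s : outer_state R n) : nat :=
  find (triggered F s) (iota 0 101).

Definition outer_step (R : realType) (n : nat) (F : 'rV[R]_n -> R)
    (rho dbar : R) (s : outer_state R n) : outer_state R n :=
  let th := st_theta s in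
  if gradient F th == 0 then s else
  let: (psi, L) := inner F s (exit_index F s) in
  let g := enorm (gradient F psi) in
  let alpha0 := step_size (st_low s) (enorm (gradient F th)) (st_L0 s) in
  let low' := g / Num.sqrt 2 in
  let upp' := Num.sqrt 20 * low' in
  let enlarged := Num.min (3 / 2 * st_delta s) dbar in
  if F psi >= F th - rho * st_delta s * alpha0 * enorm (gradient F th) ^+ 2 then
    OuterState th (2^-1 * st_delta s) (st_low s) (st_upp s) L true
  else if g <= st_low s then
    OuterState psi (st_delta s) low' upp' L (psi == th)
  else if g >= st_upp s then
    OuterState psi enlarged low' upp' L (psi == th)
  else
    OuterState psi enlarged (st_low s) (st_upp s) L (psi == th).

Definition initial_state (R : realType) (n : nat) (F : 'rV[R]_n -> R)
    (theta0 : 'rV[R]_n) (delta0 : R) : outer_state R n :=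
  let g := enorm (gradient F theta0) in
  OuterState theta0 delta0 (g / Num.sqrt 2) (Num.sqrt 10 * g) 1 false.

(* Constant from the terminating iteration on, since [outer_step] fixes every
   state whose gradient vanishes. *)
Definition state (R : realType) (n : nat) (F : 'rV[R]_n -> R)
    (rho dbar delta0 : R) (theta0 : 'rV[R]_n) (k : nat) : outer_state R n :=
  iter k (outer_step F rho dbar) (initial_state F theta0 delta0).

Definition theta (R : realType) (n : nat) (F : 'rV[R]_n -> R)
    (rho dbar delta0 : R) (theta0 : 'rV[R]_n) (k : nat) : 'rV[R]_n :=
  st_theta (state F rho dbar delta0 theta0 k).

Definition delta (R : realType) (n : nat) (F : 'rV[R]_n -> R)
    (rho dbar delta0 : R) (theta0 : 'rV[R]_n) (k : nat) : R :=
  st_delta (state F rho dbar delta0 theta0 k).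

Definition next_index (R : realType) (n : nat) (th : nat -> 'rV[R]_n)
    (l : nat) : option nat :=
  match pselect (exists k, (l < k)%N && (th k != th l)) with
  | left ex => Some (ex_minn ex)
  | right _ => None
  end.

(* [None] stands for the value infinity. *)
Fixpoint accepted_index (R : realType) (n : nat) (th : nat -> 'rV[R]_n)
    (t : nat) : option nat :=
  match t with
  | 0 => Some 0%N
  | t'.+1 => obind (next_index th) (accepted_index th t')
  end.

(* Main.v *)
Require Import Defs.
From HB Require Import structures.
From mathcomp Require Import all_boot all_order all_algebra.
From mathcomp Require Import boolp classical_sets reals topology normedtype.
From mathcomp Require Import derive.
From mathcomp Require Import ring lra.

Set Implicit Arguments.
Unset Strict Implicit.
Unset Printing Implicit Defensive.

Import Order.TTheory GRing.Theory Num.Theory.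
Import numFieldNormedType.Exports.

Local Open Scope classical_set_scope.
Local Open Scope ring_scope.

(* An accepted step decreases F, so from some outer iteration on every theta_k
   lies in a fixed bounded set; the inner iterates at which a step is taken stay
   within distance 10 of it, hence in a compact set.  There the gradient is
   bounded and uniformly Lipschitz at small scales, and since the step sizes
   alpha lie in [tiny, 1/tiny + tiny], once delta_k is below a constant c every
   inner step decreases F and the first one already by more than the acceptance
   test requires.  Rejections, the only steps that shrink delta (by half), thus
   stop below c, so delta is bounded below.  In particular rejections cannot go
   on forever, so there are infinitely many accepted iterates; each one decreases F
   by at least rho * delta * tiny * |grad F|^2, and these decreases telescope. *)

(** * Sup norm against Euclidean norm, and uniform Lipschitz bounds on compact sets *)

Lemma rV_norm_ge (R : realType) (n : nat) (x : 'rV[R]_n) (i : 'I_n) :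
  `|x ord0 i| <= `|x|.
Proof.
by rewrite [leRHS]/Num.Def.normr /= mx_normrE; apply/bigmax_geP; right; exists (ord0, i).
Qed.

Lemma enorm_ge0 (R : realType) (n : nat) (x : 'rV[R]_n) : 0 <= enorm x.
Proof. exact: sqrtr_ge0. Qed.

Lemma sqr_enorm (R : realType) (n : nat) (x : 'rV[R]_n) :
  enorm x ^+ 2 = \sum_(i < n) x ord0 i ^+ 2.
Proof. by rewrite sqr_sqrtr// sumr_ge0// => i _; exact: sqr_ge0. Qed.

Lemma rV_norm_le_enorm (R : realType) (n : nat) (x : 'rV[R]_n) :
  `|x| <= enorm x.
Proof.
rewrite [leLHS]/Num.Def.normr /= mx_normrE; apply: bigmax_le => [|[i j] _ /=].
  exact: enorm_ge0.
rewrite -(ler_pXn2r (n := 2))// ?nnegrE ?enorm_ge0// sqr_enorm ord1.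
rewrite (bigD1 j)//= real_normK ?num_real// lerDl.
by rewrite sumr_ge0// => k _; exact: sqr_ge0.
Qed.

Lemma enorm0 (R : realType) (n : nat) : enorm (0 : 'rV[R]_n) = 0.
Proof.
apply/eqP; rewrite -sqrf_eq0 sqr_enorm big1// => i _.
by rewrite mxE expr0n.
Qed.

Lemma enorm_gt0 (R : realType) (n : nat) (x : 'rV[R]_n) :
  x != 0 -> 0 < enorm x.
Proof. by move=> x0; apply: lt_le_trans (rV_norm_le_enorm x); rewrite normr_gt0. Qed.

(* A single M serves as bound on f, as Lipschitz constant, and as inverse of the
   radius of validity, which spares
   any convexity assumption on K. *)
Lemma locally_lipschitz_compact (R : realType) (n m : nat)
    (f : 'rV[R]_n -> 'rV[R]_m) (K : set 'rV[R]_n) :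
  locally_lipschitz f -> compact K ->
  \forall M \near +oo, forall x, K x -> `|f x| <= M /\
    forall y, `|x - y| * M <= 1 -> `|f x - f y| <= M * `|x - y|.
Proof.
move=> f_lip /compact_near_coveringP /(_ R +oo).
move=> /(_ (fun M x => `|f x| <= M /\
  forall y, `|x - y| * M <= 1 -> `|f x - f y| <= M * `|x - y|)).
apply=> x _; have [r r0 [L [Lreal Llip]]] := f_lip x.
(* [Llip] only yields Lipschitz constants strictly above [L], hence [L + 1]; the maximum with 1
   makes the constant positive. *)
pose L1 := Num.max 1 (L + 1).
have L1_gt0 : 0 < L1 by rewrite lt_max ltr01.
have lipL1 y z : ball x r y -> ball x r z -> `|f y - f z| <= L1 * `|y - z|.
  have LL1 : L < L1 by rewrite lt_max ltrDl ltr01 orbT.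
  by move=> xy xz; apply: (Llip _ LL1 (y, z)).
near=> x' M.
have xx' : ball x (r / 2) x' by near: x'; apply: nbhsx_ballx; rewrite divr_gt0.
have L1M : L1 <= M by near: M; apply: nbhs_pinfty_ge; rewrite num_real.
(* With [M] at least [4 / r], the condition on [y] forces [y] within [r / 4] of [x'], hence strictly
   inside the ball around [x]. *)
have rM : 4 / r <= M by near: M; apply: nbhs_pinfty_ge; rewrite num_real.
have fM : `|f x| + L1 * r <= M.
  by near: M; apply: nbhs_pinfty_ge; rewrite num_real.
have x'r : ball x r x' by apply: le_ball xx'; rewrite ler_pdivrMr// ler_peMr// ?ler1n// ltW.
split.
  have x'x : `|x' - x| <= r by rewrite distrC ltW// -ball_normE in x'r *.
  have h := ler_normD (f x' - f x) (f x); rewrite subrK in h.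
  apply: le_trans h (le_trans _ fM); rewrite addrC lerD2l.
  apply: (le_trans (lipL1 _ _ x'r (ballxx x r0))).
  exact: ler_wpM2l (ltW L1_gt0) _ _ x'x.
move=> y xyM; apply: (le_trans (lipL1 _ _ x'r _)); last exact: ler_wpM2r.
rewrite (splitr r); apply: ball_triangle xx' _.
rewrite -ball_normE /=.
have : `|x' - y| * (4 / r) <= 1 by apply: le_trans xyM; exact: ler_wpM2l.
rewrite mulrA ler_pdivrMr// mul1r => h.
by rewrite ltr_pdivlMr//; have := normr_ge0 (x' - y); lra.
Unshelve. all: by end_near. Qed.

(** * Descent along one gradient step *)

Lemma derive_gradient (R : realType) (n : nat) (F : 'rV[R]_n -> R)
    (x v : 'rV[R]_n) : differentiable F x ->
  'D_v F x = \sum_(i < n) v ord0 i * gradient F x ord0 i.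
Proof.
move=> dF; rewrite deriveE// {1}(row_sum_delta v) linear_sum.
by apply: eq_bigr => i _; rewrite linearZ /= mxE deriveE.
Qed.

(** Both derivatives are limits of literally the same difference quotient, so no chain rule is
    involved. *)
Lemma is_derive_along (R : realType) (V W : normedModType R) (f : V -> W)
    (x v : V) (t : R) : derivable f (x + t *: v) v ->
  is_derive t 1 (fun u => f (x + u *: v)) ('D_v f (x + t *: v)).
Proof.
have E : (fun h : R => h^-1 *: (((fun u : R => f (x + u *: v)) \o shift t) (h *: 1)
                                - f (x + t *: v))) =
    (fun h : R => h^-1 *: ((f \o shift (x + t *: v)) (h *: v) - f (x + t *: v))).
  by apply/funext => h /=; rewrite scalerDl addrCA [h *: 1]mulr1.
by move=> df; split; rewrite ?/derivable /derive E.
Qed.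

(** Mean value theorem on the segment from [x] to [x - h *: g]. The bound on [h * |g| * M] keeps the
    segment inside the radius where the Lipschitz estimate at [x] is valid. The factor [n] comes
    from bounding an inner product coordinatewise by sup norms. *)
Lemma gradient_step_decrease (R : realType) (n : nat) (F : 'rV[R]_n -> R)
    (x : 'rV[R]_n) (h M : R) (g := gradient F x) :
  (forall y, differentiable F y) ->
  0 <= h -> 0 <= M -> h * `|g| * M <= 1 ->
  (forall y, `|x - y| * M <= 1 -> `|g - gradient F y| <= M * `|x - y|) ->
  F (x - h *: g) <= F x - h * (1 - n%:R * M * h) * enorm g ^+ 2.
Proof.
move=> dF h0 M0 hgM lipM.
pose v := - h *: g.
have dphi (t : R) := is_derive_along (@diff_derivable _ _ _ F _ v (dF (x + t *: v))).
have [|t] := MVT_segment (ler01 : 0 <= 1 :> R) (fun t _ => dphi t).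
  by apply: derivable_within_continuous => t _; case: (dphi t).
rewrite in_itv /= => /andP[t0 t1]; rewrite scale1r scale0r addr0 subr0 mulr1.
set y := x + t *: v => FE.
have Ev : x + v = x - h *: g by rewrite /v scaleNr.
rewrite Ev in FE.
have xy : x - y = (t * h) *: g.
  by rewrite /y /v opprD addNKr scalerA mulrN scaleNr opprK.
have nxy : `|x - y| <= h * `|g|.
  by rewrite xy normrZ ger0_norm ?mulr_ge0// ler_wpM2r// ler_piMl.
have gy : `|g - gradient F y| <= M * (h * `|g|).
  apply: (le_trans (lipM _ _)); last exact: ler_wpM2l.
  exact: le_trans (ler_wpM2r M0 nxy) hgM.
have gn : `|g| ^+ 2 <= enorm g ^+ 2.
  by rewrite ler_pXn2r ?nnegrE ?enorm_ge0// rV_norm_le_enorm.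
have dot : \sum_(i < n) g ord0 i * (g - gradient F y) ord0 i
    <= n%:R * M * h * enorm g ^+ 2.
  have -> : n%:R * M * h * enorm g ^+ 2 = \sum_(i < n) M * h * enorm g ^+ 2.
    by rewrite sumr_const card_ord -[RHS]mulr_natl; ring.
  apply: ler_sum => i _; apply: le_trans (ler_norm _) _; rewrite normrM.
  apply: (@le_trans _ _ (`|g| * (M * (h * `|g|)))).
    apply: ler_pM; rewrite ?normr_ge0 ?rV_norm_ge//.
    exact: le_trans (rV_norm_ge _ _) gy.
  have -> : `|g| * (M * (h * `|g|)) = M * h * `|g| ^+ 2 by ring.
  by rewrite ler_wpM2l// mulr_ge0.
have Dv : 'D_v F y = - h * (enorm g ^+ 2
    - \sum_(i < n) g ord0 i * (g - gradient F y) ord0 i).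
  rewrite derive_gradient// sqr_enorm -sumrB mulr_sumr.
  by apply: eq_bigr => i _; rewrite /v !mxE; ring.
move: FE; rewrite Dv => /eqP; rewrite subr_eq => /eqP ->.
have := ler_wpM2l h0 dot; lra.
Qed.

(** * Step sizes and the inner loop *)

Lemma tiny_gt0 (R : realType) : 0 < tiny :> R.
Proof. by rewrite invr_gt0 exprn_gt0. Qed.

Lemma step_size_ge (R : realType) (low g L : R) : 0 <= g -> 0 <= L ->
  tiny <= step_size low g L.
Proof.
move=> g0 L0; have t0 := tiny_gt0 R; have g2 := sqr_ge0 g.
have gL : 0 <= g ^+ 2 * L by rewrite mulr_ge0.
have g3 : 0 <= g ^+ 3 by rewrite exprn_ge0.
rewrite lerDr le_min invr_ge0 divr_ge0 ?sqr_ge0//=; lra.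
Qed.

Lemma step_size_le (R : realType) (low g L : R) : 0 <= g -> 0 <= L ->
  step_size low g L <= tiny^-1 + tiny.
Proof.
move=> g0 L0; have t0 := tiny_gt0 R.
(* The second entry of the minimum suffices: its denominator is at least [tiny]. *)
rewrite lerD2r ge_min; apply/orP; right.
rewrite lef_pV2 ?posrE; lra.
Qed.

(* The last clause says that the inner loop is not triggered at j = 0. *)
Definition valid (R : realType) (n : nat) (F : 'rV[R]_n -> R) (dbar : R)
    (s : outer_state R n) : Prop :=
  [/\ 0 < st_delta s <= dbar, 0 <= st_L0 s &
      gradient F (st_theta s) != 0 ->
      st_low s < enorm (gradient F (st_theta s)) < st_upp s].

Lemma inner_L_ge0 (R : realType) (n : nat) (F : 'rV[R]_n -> R)
    (s : outer_state R n) (j : nat) :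
  0 <= st_L0 s -> 0 <= (inner F s j).2.
Proof.
move=> L0; elim: j => //= j; case: inner => psi L /= _.
by case: ifP => _; rewrite ?le_max divr_ge0 ?enorm_ge0.
Qed.

(** Validity rules out a trigger at 0, so the exit index is a successor; since 100 always triggers,
    [find] does not run off the list. *)
Lemma exit_indexP (R : realType) (n : nat) (F : 'rV[R]_n -> R) (dbar : R)
    (s : outer_state R n) :
  valid F dbar s -> gradient F (st_theta s) != 0 ->
  exists2 j, exit_index F s = j.+1
    & forall i, (i <= j)%N -> ~~ triggered F s i.
Proof.
move=> [_ _ /[apply] th_ok].
have : ~~ triggered F s 0 by rewrite /triggered /= subrr enorm0 th_ok ltNge ler0n.
have has_trig : has (triggered F s) (iota 0 101).
  by apply/hasP; exists 100%N; rewrite ?mem_iota// /triggered eqxx !orbT.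
have := nth_find 0%N has_trig.
have := has_trig; rewrite has_find size_iota -/(exit_index F s) => e101.
rewrite nth_iota// add0n.
case E : (exit_index F s) => [|j]; first by move=> ->.
move=> _ _; exists j => // i ij.
have i101 : (i < 101)%N by rewrite (leq_ltn_trans ij)// ltnW// -E.
have : (i < exit_index F s)%N by rewrite E.
by move=> /(before_find 0%N); rewrite nth_iota// add0n => ->.
Qed.

(** The first inner step uses exactly the step size of the acceptance test, and its decrease factor
    exceeds [rho], which gives strict inequality; the remaining steps only need not to increase
    [F]. *)
Lemma inner_decrease (R : realType) (n : nat) (F : 'rV[R]_n -> R) (dbar M B rho : R)
    (s : outer_state R n) (alpha := tiny^-1 + tiny) (th := st_theta s) :
  (forall y, differentiable F y) -> 0 < rho ->
  (forall x, `|x| <= B + 10 -> `|gradient F x| <= M /\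
    forall y, `|x - y| * M <= 1 ->
              `|gradient F x - gradient F y| <= M * `|x - y|) ->
  0 <= M -> st_delta s * alpha * (M * M) <= 1 ->
  n%:R * M * (st_delta s * alpha) < 1 - rho ->
  `|th| <= B ->
  valid F dbar s -> gradient F th != 0 ->
  F (inner F s (exit_index F s)).1 < F th
    - rho * st_delta s * step_size (st_low s) (enorm (gradient F th)) (st_L0 s)
      * enorm (gradient F th) ^+ 2.
Proof.
move=> dF rho0 F_M M0 dM nMd thB s_ok g0.
have [/andP[d0 _] L0 _] := s_ok.
have [j -> not_trig] := exit_indexP s_ok g0.
have a_ge0 i (low := st_low s) (g := enorm (gradient F (inner F s i).1)) 
    (L := (inner F s i).2) : 0 <= st_delta s * step_size low g L <= st_delta s * alpha.
  have Li := inner_L_ge0 F i L0; have gi := enorm_ge0 (gradient F (inner F s i).1).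
  rewrite mulr_ge0 ?ler_wpM2l ?(ltW d0) ?step_size_le//.
  by rewrite (le_trans (ltW (tiny_gt0 R)))// step_size_ge.
have step i : (i <= j)%N ->
  let: (psi, L) := inner F s i in
  let h := st_delta s * step_size (st_low s) (enorm (gradient F psi)) L in
  F (inner F s i.+1).1 <= F psi
    - h * (1 - n%:R * M * (st_delta s * alpha)) * enorm (gradient F psi) ^+ 2.
  move=> /not_trig; have := a_ge0 i; rewrite /triggered /=.
  case: (inner F s i) => psi L /= /andP[h0 ha].
  rewrite negb_or -leNgt => /andP[psi10 _].
  have /F_M[gM gL] : `|psi| <= B + 10.
    rewrite -(subrK th psi) addrC (le_trans (ler_normD _ _))// lerD//.
    exact: le_trans (rV_norm_le_enorm _) psi10.
  set h := _ * step_size _ _ _ in h0 ha *.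
  apply: le_trans (gradient_step_decrease dF h0 M0 _ gL) _.
    rewrite -mulrA; apply: le_trans dM.
    by rewrite ler_pM// ?mulr_ge0// ler_wpM2r.
  rewrite lerD2l lerN2 ler_wpM2r ?sqr_ge0// ler_wpM2l//.
  by rewrite lerB// ler_wpM2l// mulr_ge0.
have nMd1 : rho < 1 - n%:R * M * (st_delta s * alpha) by lra.
have mono i : (i <= j)%N -> F (inner F s i.+1).1 <= F (inner F s 1).1.
  elim: i => [//|i IH] ij; apply: le_trans (IH (ltnW ij)).
  have := step _ ij; have := a_ge0 i.+1.
  case: (inner F s i.+1) => psi L /= /andP[h0 _] /le_trans -> //.
  rewrite gerBl mulr_ge0 ?sqr_ge0// mulr_ge0//.
  exact: ltW (lt_trans rho0 nMd1).
apply: le_lt_trans (mono j (leqnn j)) _.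
apply: le_lt_trans (step 0%N (leq0n j)) _ => /=.
rewrite ltrD2l ltrN2 ltr_pM2r ?exprn_gt0 ?enorm_gt0//.
rewrite -mulrA mulrC ltr_pM2l// mulr_gt0//.
by rewrite (lt_le_trans (tiny_gt0 R))// step_size_ge// enorm_ge0.
Qed.

(* The factor sqrt 20 is applied to the new lower threshold, so that the upper one
   is sqrt 10 * g. *)
Lemma reset_thresholds (R : realType) (g : R) :
  0 < g -> g / Num.sqrt 2 < g < Num.sqrt 20 * (g / Num.sqrt 2).
Proof.
move=> g0; have s2 : 0 < Num.sqrt 2 :> R by rewrite sqrtr_gt0.
apply/andP; split.
  by rewrite ltr_pdivrMr// ltr_pMr// -[ltLHS]sqrtr1 ltr_sqrt// ltr1n.
by rewrite mulrCA ltr_pMr// ltr_pdivlMr// mul1r ltr_sqrt// ltr_nat.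
Qed.

(** * The invariant and the outcome of one outer iteration *)

Lemma valid_initial (R : realType) (n : nat) (F : 'rV[R]_n -> R) (dbar delta0 : R)
    (theta0 : 'rV[R]_n) :
  0 < delta0 <= dbar -> valid F dbar (initial_state F theta0 delta0).
Proof.
move=> d0; split=> //= /enorm_gt0 g0; case/andP: (reset_thresholds g0) => -> _ /=.
by rewrite ltr_pMl// -[ltLHS]sqrtr1 ltr_sqrt// ltr1n.
Qed.

(** The three accepting branches merge, with the step size weakened to [tiny] for telescoping. A
    rejection keeps the exact failed test, so that it can be refuted when delta is small. *)
Variant outer_step_spec (R : realType) (n : nat) (F : 'rV[R]_n -> R)
    (rho : R) (s s' : outer_state R n) (g := enorm (gradient F (st_theta s))) :
    Prop :=
| Rejected of st_theta s' = st_theta s & st_delta s' = 2^-1 * st_delta s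
    & F (st_theta s)
        - rho * st_delta s * step_size (st_low s) g (st_L0 s) * g ^+ 2
      <= F (inner F s (exit_index F s)).1
| Accepted of st_delta s <= st_delta s'
    & F (st_theta s') < F (st_theta s) - rho * st_delta s * tiny * g ^+ 2.

Lemma outer_stepP (R : realType) (n : nat) (F : 'rV[R]_n -> R)
    (rho dbar : R) (s : outer_state R n) (s' := outer_step F rho dbar s) :
  0 < rho -> valid F dbar s -> gradient F (st_theta s) != 0 ->
  valid F dbar s' /\ outer_step_spec F rho s s'.
Proof.
move=> rho0 s_ok g0; have [/andP[d0 ddbar] L0 th_ok] := s_ok.
have low_upp := th_ok g0.
have dbar0 : 0 < dbar by apply: lt_le_trans ddbar.
have L0' := inner_L_ge0 F (exit_index F s) L0.
rewrite {}/s' /outer_step (negbTE g0).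
case E : (inner F s (exit_index F s)) L0' => [psi L] /= L0'.
have enlarged : 0 < Num.min (3 / 2 * st_delta s) dbar <= dbar.
  rewrite ge_min lexx orbT andbT lt_min dbar0 andbT; lra.
have enlarged_ge : st_delta s <= Num.min (3 / 2 * st_delta s) dbar.
  by rewrite le_min ddbar andbT; lra.
case: (leP (F (st_theta s) - _)) => [rej|acc].
  split; last by apply: Rejected; rewrite ?E.
  by split=> //=; apply/andP; split; lra.
have acc' : F psi < F (st_theta s)
    - rho * st_delta s * tiny * enorm (gradient F (st_theta s)) ^+ 2.
  apply: lt_le_trans acc _; rewrite lerD2l lerN2 ler_wpM2r ?sqr_ge0//.
  by rewrite ler_wpM2l ?step_size_ge ?enorm_ge0// mulr_ge0// ltW.
have reset : gradient F psi != 0 ->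
    let g := enorm (gradient F psi) in
    g / Num.sqrt 2 < g < Num.sqrt 20 * (g / Num.sqrt 2).
  by move=> /enorm_gt0; exact: reset_thresholds.
case: leP => [_|low]; first by do 2?split=> //=; rewrite ?d0 ?ddbar//; exact: Accepted.
case: leP => [_|upp]; first by do 2?split=> //=; exact: Accepted.
by split; [split=> //= _; rewrite low upp | exact: Accepted].
Qed.

(** * Accepted indices and auxiliary bounds *)

Lemma next_indexP (R : realType) (n : nat) (th : nat -> 'rV[R]_n) (l : nat) :
  (exists k, (l < k)%N && (th k != th l)) ->
  exists2 m, next_index th l = Some m.+1 &
    [/\ (l <= m)%N, th m = th l & th m.+1 != th l].
Proof.
move=> ex; rewrite /next_index; case: pselect => // ex'.
case: ex_minnP => -[|m] // /andP[lm thm] min_m; exists m => //; split=> //.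
move: lm; rewrite ltnS leq_eqVlt => /orP[/eqP -> //|lm].
(* Were [th m] different from [th l], minimality of [m.+1] would give [m.+1 <= m]. *)
apply/eqP; apply: contraTT (ltnSn m) => thml.
by rewrite -leqNgt min_m// lm.
Qed.

(** The starting value [x0] is arbitrary because it can only lower the minimum. *)
Lemma bigmin_le_mean (R : realType) (a : nat -> R) (x0 : R) (T : nat) :
  T%:R * \big[Num.min/x0]_(t < T) a t <= \sum_(t < T) a t.
Proof.
rewrite mulr_natl -[X in _ *+ X]card_ord -sumr_const.
by apply: ler_sum => i _; exact: bigmin_le_cond.
Qed.

Lemma bounded_set_normP (R : realType) (n : nat) (A : set 'rV[R]_n) :
  bounded_set A -> exists B : R, forall x, A x -> `|x| <= B.
Proof.
move=> [B [_ AB]]; exists (B + 1) => x Ax.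
by apply: (AB _ _ _ Ax); rewrite ltrDl.
Qed.

(** The threshold [c] is chosen before the state, so it serves all outer iterations whose iterate
    has norm at most [B]. *)
Lemma accept_small_delta (R : realType) (n : nat) (F : 'rV[R]_n -> R) (dbar B rho : R) :
  (forall y, differentiable F y) -> locally_lipschitz (gradient F) ->
  0 < rho < 1 ->
  exists2 c : R, 0 < c & forall s : outer_state R n,
    valid F dbar s -> gradient F (st_theta s) != 0 ->
    `|st_theta s| <= B -> st_delta s < c ->
    F (inner F s (exit_index F s)).1 < F (st_theta s)
      - rho * st_delta s
        * step_size (st_low s) (enorm (gradient F (st_theta s))) (st_L0 s)
        * enorm (gradient F (st_theta s)) ^+ 2.
Proof.
move=> dF gradF_lip /andP[rho0 rho1].
pose K := [set x : 'rV[R]_n | `|x| <= B + 10].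
have K_compact : compact K.
  apply: bounded_closed_compact.
    exists (B + 10); split; first exact: num_real.
    by move=> M BM x /= xB; rewrite (le_trans xB)// ltW.
  rewrite /K -[X in closed X]/((fun x : 'rV[R]_n => `|x|) @^-1` [set r | r <= B + 10]).
  by apply: closed_comp => [x _|]; [exact: norm_continuous | exact: closed_le].
have [M [M1 F_M]] : exists M : R, 1 <= M /\ forall x, K x ->
    `|gradient F x| <= M /\ forall y, `|x - y| * M <= 1 ->
    `|gradient F x - gradient F y| <= M * `|x - y|.
  apply: (@filter_ex _ (+oo : set_system R)); apply: filterI.
    exact: nbhs_pinfty_ge (num_real _).
  exact: locally_lipschitz_compact.
have M0 : 0 < M by apply: lt_le_trans M1.
pose alpha : R := tiny^-1 + tiny.
have alpha0 : 0 < alpha by rewrite addr_gt0 ?tiny_gt0// invr_gt0 tiny_gt0.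
(* The first bound keeps each inner step within the Lipschitz radius, the second makes the decrease
   factor exceed [rho]. Using [n.+1] avoids a zero denominator when [n] is 0. *)
exists (Num.min (alpha * (M * M))^-1 ((1 - rho) / (n.+1%:R * M * alpha))).
  by rewrite lt_min invr_gt0 divr_gt0 ?subr_gt0// ?mulr_gt0 ?ltr0n.
move=> s s_ok g0 thB; rewrite lt_min => /andP[d1 d2].
have [/andP[d0 _] _ _] := s_ok.
apply: (inner_decrease dF rho0 F_M (ltW M0) _ _ thB s_ok g0).
  by rewrite -mulrA -ler_pdivlMr ?mulr_gt0// mul1r ltW.
move: d2; rewrite ltr_pdivlMr ?mulr_gt0 ?ltr0n//; apply: le_lt_trans.
rewrite (_ : n%:R * M * (st_delta s * alpha) = st_delta s * (n%:R * M * alpha)); last by ring.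
by rewrite ler_wpM2l ?(ltW d0)// !ler_wpM2r ?ler_nat ?(ltW M0) ?(ltW alpha0).
Qed.

(** * Lower bound on delta, infinitely many moves, and the telescoped estimate *)

Theorem theorem3 (R : realType) (n : nat) (F : 'rV[R]_n -> R) (Flb : R)
    (rho dbar delta0 : R) (theta0 : 'rV[R]_n)
    (F_cont : continuous F)
    (F_lb : forall x : 'rV[R]_n, Flb <= F x)
    (F_diff : forall x : 'rV[R]_n, differentiable F x)
    (gradF_lip : locally_lipschitz (gradient F))
    (rho_bounds : 0 < rho < 1)
    (dbar_gt0 : 0 < dbar)
    (delta0_bounds : 0 < delta0 <= dbar) :
  let th := theta F rho dbar delta0 theta0 in
  let dl := delta F rho dbar delta0 theta0 in
  (exists (k : nat) (s : R),
      bounded_set [set psi : 'rV[R]_n | F psi <= s] /\ F (th k) <= s) ->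
  (exists K : nat, gradient F (th K) = 0) \/
  (exists udelta : R,
    [/\ 0 < udelta,
        forall k : nat, udelta <= dl k
      & exists ell : nat -> nat,
          (forall t : nat, accepted_index th t = Some (ell t)) /\
          forall T : nat, (0 < T)%N ->
            \big[Num.min/enorm (gradient F (th (ell 0%N))) ^+ 2]_(t < T)
                enorm (gradient F (th (ell t))) ^+ 2
            <= (F theta0 - Flb) / (T%:R * rho * udelta * 10 ^- 16)]).
Proof.
move=> th dl [k0 [s [/bounded_set_normP[B level_B] th_s]]].
have [|no_stop] := pselect (exists K, gradient F (th K) = 0); first by left.
right; have /andP[rho0 _] := rho_bounds.
have g0 k : gradient F (th k) != 0.
  by apply/eqP => gk; apply: no_stop; exists k.
pose st := state F rho dbar delta0 theta0.
have valid_st k : valid F dbar (st k).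
  elim: k => [|k IH]; first exact: valid_initial.
  by have [] := outer_stepP rho0 IH (g0 k).
have spec k : outer_step_spec F rho (st k) (st k.+1).
  by have [] := outer_stepP rho0 (valid_st k) (g0 k).
have dl_gt0 k : 0 < dl k by have [/andP[]] := valid_st k.
have F_step k : F (th k.+1) <= F (th k).
  rewrite /th /theta -/st; case: (spec k) => [-> //| _ /ltW /le_trans]; apply.
  rewrite gerBl mulr_ge0 ?sqr_ge0// ltW// mulr_gt0 ?tiny_gt0//.
  by rewrite mulr_gt0 ?dl_gt0.
have th_B k : (k0 <= k)%N -> `|th k| <= B.
  move=> /subnKC <-; apply: level_B => /=; elim: (k - k0)%N => [|i IH].
    by rewrite addn0.
  by rewrite addnS (le_trans (F_step _)).
have [c c0 accept] := accept_small_delta dbar B F_diff gradF_lip rho_bounds.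
(* The first [k0] iterations, where no bound on the iterates is at hand, halve delta at most [k0]
   times. Later a rejection needs delta at least [c], so it leaves at least [c / 2]. *)
pose udelta := Num.min (delta0 / 2 ^+ k0) (c / 2).
have dl_half k : dl k / 2 <= dl k.+1.
  case: (spec k) => [_ d _|d _]; rewrite /dl /delta -/st.
    by rewrite d mulrC.
  by apply: le_trans d; have := ltW (dl_gt0 k); rewrite /dl /delta -/st; lra.
have dl_early k : delta0 / 2 ^+ k <= dl k.
  elim: k => [|k IH]; first by rewrite divr1.
  apply: le_trans (dl_half k); rewrite exprSr invfM mulrA.
  by rewrite ler_wpM2r ?invr_ge0.
have /andP[d0 _] := delta0_bounds.
have udelta_gt0 : 0 < udelta by rewrite lt_min !divr_gt0 ?exprn_gt0.
have udelta_late k : (k0 <= k)%N -> udelta <= dl k.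
  elim: k => [|k IH].
    by rewrite leqn0 => /eqP k00; rewrite ge_min (le_trans _ (dl_early _))// k00.
  rewrite leq_eqVlt => /orP[/eqP <-|k0k]; first by rewrite ge_min dl_early.
  have [dc|cd] := ltP (dl k) c; last first.
    apply: le_trans (dl_half k); rewrite ge_min; apply/orP; right.
    by rewrite ler_wpM2r ?invr_ge0.
  case: (spec k) => [_ _|d _]; last exact: le_trans (IH k0k) d.
  by rewrite leNgt (accept _ (valid_st k) (g0 k) (th_B _ k0k) dc).
have udeltaP k : udelta <= dl k.
  have [/udelta_late //|/ltnW kk0] := leqP k0 k.
  apply: le_trans (dl_early k); rewrite ge_min; apply/orP; left.
  by rewrite ler_wpM2l ?(ltW d0)// lef_pV2 ?posrE ?exprn_gt0// ler_weXn2l ?ler1n.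
(* If the iterate never moved after [l], every step would be a rejection, because acceptance
   strictly decreases [F]; repeated halving would then push delta below [udelta]. *)
have moves l : exists k, (l < k)%N && (th k != th l).
  apply: contrapT => stuck.
  have th_l i : th (l + i)%N = th l.
    case: i => [|i]; first by rewrite addn0.
    apply: contrapT => /eqP thi; apply: stuck; exists (l + i.+1)%N.
    by rewrite thi addnS ltnS leq_addr.
  have dl_l i : dl (l + i)%N = dl l / 2 ^+ i.
    elim: i => [|i IH]; first by rewrite addn0 divr1.
    rewrite exprSr invfM mulrA -IH addnS.
    case: (spec (l + i)%N) => [_ d _|_]; first by rewrite mulrC.
    rewrite -[st_theta (st _.+1)]/(th _) -[st_theta (st _)]/(th _) -addnS !th_l.
    rewrite ltNge lerBlDr lerDl mulr_ge0 ?sqr_ge0// ltW// mulr_gt0 ?tiny_gt0//.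
    by rewrite mulr_gt0 ?dl_gt0.
  (* Enough halvings: [2 ^+ i] exceeds [i], hence the ratio [dl l / udelta]. *)
  pose i := Num.bound (dl l / udelta).
  have : dl l / udelta < 2 ^+ i.
    apply: lt_le_trans (archi_boundP _) _; first by rewrite divr_ge0// ltW.
    by rewrite -/i -natrX ler_nat ltnW// ltn_expl.
  rewrite ltr_pdivrMr// mulrC -ltr_pdivrMr ?exprn_gt0// -dl_l.
  by rewrite ltNge udeltaP.
have ellP t : exists l : nat, accepted_index th t = Some l.
  elim: t => [|t [l IH]]; first by exists 0%N.
  by have [m E _] := next_indexP (moves l); exists m.+1; rewrite /= IH.
exists udelta; split=> //.
have [ell ell_acc] := choice ellP.
exists ell; split=> // T T0.
pose a t := enorm (gradient F (th (ell t))) ^+ 2.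
pose q := rho * udelta * (10 ^- 16).
have q0 : 0 < q by rewrite !mulr_gt0// tiny_gt0.
have ell_step t : q * a t <= F (th (ell t)) - F (th (ell t.+1)).
  have := ell_acc t.+1; rewrite /= ell_acc /=.
  (* The move happens in iteration [m], whose iterate is still that of [ell t]; so the decrease at
     [m] is measured with the gradient at [ell t], and rejection is excluded. *)
  have [m -> [lm thm thm1] [<-]] := next_indexP (moves (ell t)).
  case: (spec m) => [thm1'|_ /ltW]; first by case/eqP: thm1; exact: etrans thm1' thm.
  rewrite -![st_theta _]/(th _) thm -/(a t) => F_m1.
  rewrite lerBrDl -lerBrDr; apply: le_trans F_m1 _; rewrite lerD2l.
  rewrite lerN2 ler_wpM2r ?sqr_ge0// ler_wpM2r ?(ltW (tiny_gt0 R))//.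
  by rewrite ler_wpM2l ?(ltW rho0)//; exact: udeltaP.
have sum_a t : q * (\sum_(i < t) a i) <= F theta0 - F (th (ell t)).
  elim: t => [|t IH].
    by have [<-] := ell_acc 0%N; rewrite big_ord0 mulr0 subrr.
  by rewrite big_ord_recr mulrDr; have := ell_step t; lra.
rewrite (_ : T%:R * rho * udelta * 10 ^- 16 = T%:R * q); last by rewrite /q !mulrA.
have Tq0 : 0 < T%:R * q by apply: mulr_gt0; rewrite ?ltr0n.
rewrite ler_pdivlMr// mulrC -mulrA mulrCA.
(* The telescoped sum leaves [F] at the last accepted iterate, which is bounded below by [Flb]. *)
apply: le_trans (lerB (lexx _) (F_lb (th (ell T)))); apply: le_trans (sum_a T).
rewrite ler_wpM2l ?(ltW q0)//; exact: bigmin_le_mean.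
Qed.
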